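(* The following identity holds: \begin{align*} \frac1\pi=\sum_{n=0}^{\infty}&\frac{\left(\frac13\right)_n\left(\frac12\right)_n\left(\frac23\right)_n}{(1)_n^3}\left(\frac{22617\sqrt{15}+27314\sqrt{10}-36036\sqrt6-87049}{3375}\right)^n\\ &\times\left(\frac{54\sqrt{15}+68\sqrt{10}-72\sqrt6-193}{135}+\frac{63\sqrt{15}+71\sqrt{10}-63\sqrt6-217}{45}\,n\right). \end{align*}
   Context: The Pochhammer symbol is $(u)_0=1$ and $(u)_n=u(u+1)\cdots(u+n-1)$ for $n\ge1$; $(1)_n^3$ means $((1)_n)^3=(n!)^3$. *)

(* Defs.v *)
From Stdlib Require Import Reals.
Open Scope R_scope.

Fixpoint pochhammer (u : R) (n : nat) : R :=
  match n with
  | O => 1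
  | S m => pochhammer u m * (u + INR m)
  end.

(* Main.v *)
Require Import Defs.
From Stdlib Require Import Reals Lra Lia.
From Coquelicot Require Import Coquelicot.
Open Scope R_scope.

(** Let [F4], [F3], [F6] be the functions 2F1(1/4,3/4;1), 2F1(1/3,2/3;1) and
    2F1(1/6,1/3;1).  By Clausen's formula ([clausen]) the series is a
    combination [A * F6 ^ 2 + 2 * B * F6 * (z * F6')] at a point [z], so it is
    enough to know one linear relation between [F6 ^ 2] and [F6 * (z * F6')]
    there.  That relation comes from the arithmetic of a point with complex
    multiplication by the square root of -30, but it can be derived with
    differential equations only.

    The number pi enters through the Wronskian of [F4 x] and [F4 (1 - x)]
    ([hyp_wronskian]): it is constant, and its value near the endpoint is the
    limit of [n] times the [n]-th coefficient of [F4], a product of two central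
    binomial coefficients, which Wallis' product evaluates.

    A modular equation says that, along an algebraic curve with two coordinates
    [al] and [be], [F (al t) = m t * G (be t)] with an algebraic multiplier [m].
    Such an identity holds as soon as both sides satisfy the same second order
    equation, since the solution that is regular at [t = 0] is unique.  Lemma
    [modular_transformation] reduces this to three identities between rational
    functions, and it also gives the derivatives on both sides.

    Four transformations are used.  Three of them live on the modular curve of
    level 6, with parameter [p]: if [cubic_beta p] is the cubic modulus at the
    nome [q ^ 2], then [cubic_alpha p] is the one at [q], and [quartic_mod p],
    [quartic_mod3 p] are the moduli of signature four at [q] and [q ^ 3]; all
    of their hypergeometric functions are thus multiples of [F3 (cubic_beta p)].
    The fourth one relates the moduli of signature four at [q] and [q ^ 5], and
    is parametrised by the curve of level 10.

    Take [tau = i * sqrt 30 / 6] and [q = exp (2 * PI * i * tau)].  The Fricke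
    involution [tau -> - 1 / (2 * tau)] of level 2, which acts on the modulus by
    [x -> 1 - x], sends [tau] to [tau' = i * sqrt 30 / 10], and
    [5 * tau' = 3 * tau].  Hence, for [X] and [X3] the moduli at [tau] and
    [3 * tau], both [F4 X] and [F4 (1 - X)] are algebraic multiples of [F4 X3],
    hence of [F3 (cubic_beta p)], by the degree 3 and the degree 5
    transformations.  Their Wronskian is then a quadratic relation for [F3] at
    [cubic_beta p].  Finally [tau + 1 / 2] changes the sign of [q] and keeps
    [q ^ 2], so a second, negative, parameter [p'] has the same [cubic_beta];
    the relation moves to [cubic_alpha p'], where [z = 4 * x * (1 - x)] is the
    argument of the series.  The remaining work is arithmetic in the field
    generated by the square roots of 2, 3 and 5. *)

(** * Hypergeometric series *)

Lemma pochhammer_pos (u : R) (n : nat) : 0 < u -> 0 < pochhammer u n.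
Proof.
  intros Hu; induction n as [|n IH]; simpl; [lra|].
  apply Rmult_lt_0_compat; [exact IH|]. pose proof (pos_INR n); lra.
Qed.

Definition hyp_coef (a b : R) (n : nat) : R :=
  pochhammer a n * pochhammer b n / (pochhammer 1 n) ^ 2.

(** The operator [x * d/dx], on coefficients. *)
Definition theta (u : nat -> R) (n : nat) : R := INR n * u n.

Definition hyp (a b x : R) : R := PSeries (hyp_coef a b) x.

Definition hyp_theta (a b x : R) : R := PSeries (theta (hyp_coef a b)) x.

Lemma hyp_coef_succ (a b : R) (n : nat) :
  (INR n + 1) ^ 2 * hyp_coef a b (S n) = (INR n + a) * (INR n + b) * hyp_coef a b n.
Proof.
  unfold hyp_coef; simpl pochhammer.
  pose proof (pochhammer_pos 1 n Rlt_0_1). pose proof (pos_INR n).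
  field; split; lra.
Qed.

Lemma hyp_coef_pos (a b : R) (n : nat) : 0 < a -> 0 < b -> 0 < hyp_coef a b n.
Proof.
  intros Ha Hb; unfold hyp_coef.
  apply Rdiv_lt_0_compat; [|apply pow_lt]; repeat apply Rmult_lt_0_compat;
    apply pochhammer_pos; lra.
Qed.

Lemma hyp_coef_le_1 (a b : R) (n : nat) : 0 < a <= 1 -> 0 < b <= 1 -> hyp_coef a b n <= 1.
Proof.
  intros Ha Hb; induction n as [|n IH].
  - unfold hyp_coef; simpl; lra.
  - pose proof (hyp_coef_succ a b n) as H. pose proof (pos_INR n).
    pose proof (hyp_coef_pos a b n (proj1 Ha) (proj1 Hb)).
    apply Rmult_le_reg_l with ((INR n + 1) ^ 2); [nra|]. rewrite H.
    assert (0 <= (INR n + a) * (INR n + b) <= (INR n + 1) ^ 2) by nra. nra.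
Qed.

Lemma bounded_in_disk (u : nat -> R) (M x : R) :
  (forall n, Rabs (u n) <= M) -> Rabs x < 1 -> Rbar_lt (Rabs x) (CV_radius u).
Proof.
  intros Hu Hx.
  assert (H : Rbar_le 1 (CV_radius u)).
  { apply CV_radius_bounded. exists M. intros n. rewrite pow1, Rmult_1_r. apply Hu. }
  apply Rbar_lt_le_trans with 1; [exact Hx|exact H].
Qed.

Lemma hyp_in_disk (a b x : R) : 0 < a <= 1 -> 0 < b <= 1 -> Rabs x < 1 ->
  Rbar_lt (Rabs x) (CV_radius (hyp_coef a b)).
Proof.
  intros Ha Hb Hx. apply bounded_in_disk with 1; [|exact Hx]. intros n.
  rewrite Rabs_pos_eq; [now apply hyp_coef_le_1|].
  left; apply hyp_coef_pos; lra.
Qed.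

Lemma theta_eq (u : nat -> R) (n : nat) : theta u n = PS_incr_1 (PS_derive u) n.
Proof. destruct n; unfold theta, PS_incr_1, PS_derive; [simpl; ring_simplify; reflexivity|reflexivity]. Qed.

Lemma PSeries_theta (u : nat -> R) (x : R) :
  PSeries (theta u) x = x * PSeries (PS_derive u) x.
Proof. rewrite <- PSeries_incr_1. apply PSeries_ext, theta_eq. Qed.

Lemma CV_radius_theta (u : nat -> R) : CV_radius (theta u) = CV_radius u.
Proof.
  rewrite (CV_radius_ext _ _ (theta_eq u)), CV_radius_incr_1. apply CV_radius_derive.
Qed.

Lemma hyp_0 (a b : R) : hyp a b 0 = 1.
Proof. unfold hyp; rewrite PSeries_0; unfold hyp_coef; simpl; lra. Qed.

Lemma hyp_theta_0 (a b : R) : hyp_theta a b 0 = 0.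
Proof. unfold hyp_theta; rewrite PSeries_0; unfold theta; simpl; lra. Qed.

(** The hypergeometric equation as a first order system for the function and
    its image under [x * d/dx]; this form has no second derivative. *)
Lemma hyp_system (a b x : R) : 0 < a <= 1 -> 0 < b <= 1 -> Rabs x < 1 ->
  exists dF dE,
    is_derive (hyp a b) x dF /\ x * dF = hyp_theta a b x /\
    is_derive (hyp_theta a b) x dE /\
    (1 - x) * dE = (a + b) * hyp_theta a b x + a * b * hyp a b x.
Proof.
  intros Ha Hb Hx. pose proof (hyp_in_disk a b x Ha Hb Hx) as Hr.
  set (c := hyp_coef a b) in *.
  assert (Hr1 : Rbar_lt (Rabs x) (CV_radius (theta c))) by now rewrite CV_radius_theta.
  exists (PSeries (PS_derive c) x), (PSeries (PS_derive (theta c)) x).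
  split; [now apply is_derive_PSeries|].
  split; [symmetry; apply PSeries_theta|].
  split; [now apply is_derive_PSeries|].
  assert (Hex : forall u, CV_radius u = CV_radius c -> ex_pseries u x).
  { intros u Hu. apply CV_radius_inside. now rewrite Hu. }
  assert (Heq : PSeries (PS_derive (theta c)) x
    = PSeries (PS_plus (theta (theta c))
        (PS_plus (PS_scal (a + b) (theta c)) (PS_scal (a * b) c))) x).
  { apply PSeries_ext. intros n.
    change (INR (S n) * (INR (S n) * c (S n))
      = INR n * (INR n * c n) + ((a + b) * (INR n * c n) + a * b * c n)).
    pose proof (hyp_coef_succ a b n) as H. fold c in H.
    rewrite S_INR.
    replace ((INR n + 1) * ((INR n + 1) * c (S n))) with ((INR n + 1) ^ 2 * c (S n)) by ring.
    rewrite H. ring. }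
  rewrite !PSeries_plus, !PSeries_scal, PSeries_theta in Heq.
  - unfold hyp, hyp_theta; fold c. lra.
  - apply ex_pseries_scal; [now apply Rmult_comm|apply Hex, CV_radius_theta].
  - apply ex_pseries_scal; [now apply Rmult_comm|now apply Hex].
  - apply Hex. now rewrite !CV_radius_theta.
  - apply ex_pseries_plus; (apply ex_pseries_scal; [now apply Rmult_comm|]);
      apply Hex; [apply CV_radius_theta|reflexivity].
Qed.

Lemma hyp_pos (a b x : R) : 0 < a <= 1 -> 0 < b <= 1 -> 0 <= x < 1 -> 0 < hyp a b x.
Proof.
  intros Ha Hb Hx. unfold hyp, PSeries.
  assert (Hex : ex_series (fun n => hyp_coef a b n * x ^ n)).
  { apply ex_pseries_R, CV_radius_inside, hyp_in_disk; auto. rewrite Rabs_pos_eq; lra. }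
  assert (Hc : forall n, 0 <= hyp_coef a b n * x ^ n).
  { intros n. apply Rmult_le_pos; [left; apply hyp_coef_pos; lra|apply pow_le; lra]. }
  rewrite Series_incr_1 by exact Hex.
  assert (0 <= Series (fun k => hyp_coef a b (S k) * x ^ S k)).
  { rewrite <- (Rmult_0_l (Series (fun k => hyp_coef a b (S k) * x ^ S k))), <- Series_scal_l.
    apply Series_le; [intros n; specialize (Hc (S n)); lra|].
    now apply (ex_series_incr_1 (fun n => hyp_coef a b n * x ^ n)). }
  replace (hyp_coef a b 0) with 1 by (unfold hyp_coef; simpl; lra). rewrite pow_O. lra.
Qed.

(** * Wallis' product and the growth of the coefficients *)

Definition sin_int (n : nat) : R := RInt (fun x => sin x ^ n) 0 (PI / 2).

Lemma ex_RInt_sin_pow (n : nat) : ex_RInt (fun x => sin x ^ n) 0 (PI / 2).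
Proof.
  apply (ex_RInt_continuous (V := R_CompleteNormedModule)). intros x _.
  apply (ex_derive_continuous (K := R_AbsRing) (V := R_NormedModule)). auto_derive; exact I.
Qed.

Lemma sin_int_0 : sin_int 0 = PI / 2.
Proof.
  unfold sin_int. rewrite (RInt_ext _ (fun _ => 1)) by (intros; simpl; reflexivity).
  rewrite RInt_const. unfold scal; simpl; unfold mult; simpl. lra.
Qed.

(** The integrand is the derivative of [cos x * sin x ^ (n + 1)]. *)
Lemma is_RInt_cos_sin_pow (n : nat) :
  is_RInt (fun x => (INR n + 1) * (cos x ^ 2 * sin x ^ n) - sin x ^ (n + 2)) 0 (PI / 2) 0.
Proof.
  replace 0 with (cos (PI / 2) * sin (PI / 2) ^ (S n) - cos 0 * sin 0 ^ S n) at 2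
    by (rewrite cos_PI2, sin_0; simpl; ring).
  apply (is_RInt_derive (fun x => cos x * sin x ^ S n)
    (fun x => (INR n + 1) * (cos x ^ 2 * sin x ^ n) - sin x ^ (n + 2))).
  - intros x _. auto_derive; [exact I|].
    change (match n with O => 1 | S _ => INR n + 1 end) with (INR (S n)).
    replace (n + 2)%nat with (S (S n)) by lia. rewrite S_INR. simpl. ring.
  - intros x _. apply (ex_derive_continuous (K := R_AbsRing) (V := R_NormedModule)).
    auto_derive; exact I.
Qed.

Lemma sin_int_rec (n : nat) : (INR n + 2) * sin_int (n + 2) = (INR n + 1) * sin_int n.
Proof.
  pose proof (fun k => RInt_correct _ _ _ (ex_RInt_sin_pow k)) as Hi.
  pose proof (is_RInt_minus _ _ _ _ _ _
    (is_RInt_scal _ _ _ (INR n + 1) _ (Hi n))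
    (is_RInt_scal _ _ _ (INR n + 2) _ (Hi (n + 2)%nat))) as H.
  fold (sin_int n) (sin_int (n + 2)) in H.
  apply is_RInt_ext with
    (g := fun x => (INR n + 1) * (cos x ^ 2 * sin x ^ n) - sin x ^ (n + 2)) in H.
  - apply (is_RInt_unique (V := R_CompleteNormedModule)) in H.
    pose proof (is_RInt_unique (V := R_CompleteNormedModule) _ _ _ _ (is_RInt_cos_sin_pow n)) as H'.
    rewrite H' in H. unfold minus, plus, opp, scal in H; simpl in H; unfold mult in H; simpl in H.
    lra.
  - intros x _. unfold scal; simpl; unfold mult, minus, plus, opp; simpl.
    replace (n + 2)%nat with (S (S n)) by lia. simpl. pose proof (sin2_cos2 x) as E.
    unfold Rsqr in E. replace (cos x * (cos x * 1)) with (1 - sin x * sin x) by lra. ring.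
Qed.

Lemma sin_int_1 : sin_int 1 = 1.
Proof.
  unfold sin_int. apply (is_RInt_unique (V := R_CompleteNormedModule)).
  replace 1 with (- cos (PI / 2) - - cos 0)
    by (rewrite cos_PI2, cos_0; ring).
  apply (is_RInt_derive (V := R_CompleteNormedModule) (fun x => - cos x) (fun x => sin x ^ 1)).
  - intros x _. auto_derive; [exact I|]. simpl; ring.
  - intros x _. apply (ex_derive_continuous (K := R_AbsRing) (V := R_NormedModule)).
    auto_derive; exact I.
Qed.

Lemma sin_int_prod (n : nat) : (INR n + 1) * (sin_int n * sin_int (S n)) = PI / 2.
Proof.
  induction n as [|n IH].
  - rewrite sin_int_0, sin_int_1; simpl; lra.
  - pose proof (sin_int_rec n) as H. replace (n + 2)%nat with (S (S n)) in H by lia.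
    rewrite S_INR. rewrite <- IH.
    transitivity (sin_int (S n) * ((INR n + 2) * sin_int (S (S n)))); [ring|].
    rewrite H; ring.
Qed.

Lemma sin_int_decr (n : nat) : sin_int (S n) <= sin_int n.
Proof.
  pose proof PI_RGT_0.
  apply RInt_le; [lra|apply ex_RInt_sin_pow|apply ex_RInt_sin_pow|].
  intros x Hx. assert (0 <= sin x) by (apply sin_ge_0; lra).
  pose proof (SIN_bound x). simpl. pose proof (pow_le (sin x) n H0). nra.
Qed.

(** The central binomial coefficient [C (2 * n) n / 4 ^ n]. *)
Definition wallis (n : nat) : R := pochhammer (1 / 2) n / pochhammer 1 n.

Lemma wallis_pos n : 0 < wallis n.
Proof. apply Rdiv_lt_0_compat; apply pochhammer_pos; lra. Qed.

Lemma sin_int_even (n : nat) : sin_int (2 * n) = PI / 2 * wallis n.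
Proof.
  induction n as [|n IH].
  - simpl (2 * 0)%nat. rewrite sin_int_0. unfold wallis; simpl; field.
  - pose proof (sin_int_rec (2 * n)) as H.
    replace (2 * n + 2)%nat with (2 * S n)%nat in H by lia.
    rewrite IH, mult_INR in H. change (INR 2) with 2 in H. pose proof (pos_INR n).
    apply Rmult_eq_reg_l with (2 * INR n + 2); [|lra]. rewrite H.
    unfold wallis; simpl pochhammer. pose proof (pochhammer_pos 1 n Rlt_0_1).
    field. split; lra.
Qed.

(** The product of two consecutive sine integrals is known exactly and the
    integrals decrease, so each even one is squeezed. *)
Lemma wallis_upper (n : nat) : INR n * wallis n ^ 2 <= 1 / PI.
Proof.
  pose proof PI_RGT_0 as HP. pose proof (wallis_pos n) as Hw.
  destruct n as [|n].
  - simpl INR. rewrite Rmult_0_l. left. apply Rdiv_lt_0_compat; lra.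
  - pose proof (sin_int_prod (2 * n + 1)) as H.
    replace (S (2 * n + 1)) with (2 * S n)%nat in H by lia.
    pose proof (sin_int_decr (2 * n + 1)) as H1.
    replace (S (2 * n + 1)) with (2 * S n)%nat in H1 by lia.
    rewrite sin_int_even in H, H1.
    rewrite plus_INR, mult_INR in H. change (INR 2) with 2 in H; change (INR 1) with 1 in H.
    rewrite S_INR. pose proof (pos_INR n) as Hn.
    set (w := wallis (S n)) in *. set (s := sin_int (2 * n + 1)) in *.
    assert (Hle : 2 * (INR n + 1) * ((PI / 2 * w) * (PI / 2 * w)) <= PI / 2).
    { apply Rle_trans with (2 := Req_le _ _ H). assert (0 < PI / 2 * w) by (apply Rmult_lt_0_compat; lra).
      replace (2 * INR n + 1 + 1) with (2 * (INR n + 1)) by ring.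
      apply Rmult_le_compat_l; [lra|]. apply Rmult_le_compat_r; lra. }
    apply Rmult_le_reg_l with (PI * PI / 2); [nra|].
    replace (PI * PI / 2 * (1 / PI)) with (PI / 2) by (field; lra).
    simpl pow; lra.
Qed.

Lemma wallis_lower (n : nat) : 1 / PI <= (INR n + 1 / 2) * wallis n ^ 2.
Proof.
  pose proof PI_RGT_0 as HP. pose proof (wallis_pos n) as Hw.
  pose proof (sin_int_prod (2 * n)) as H. pose proof (sin_int_decr (2 * n)) as H1.
  rewrite sin_int_even in H, H1. rewrite mult_INR in H. change (INR 2) with 2 in H.
  pose proof (pos_INR n) as Hn. set (w := wallis n) in *.
  assert (Hle : PI / 2 <= (2 * INR n + 1) * ((PI / 2 * w) * (PI / 2 * w))).
  { apply Rle_trans with (1 := Req_le _ _ (eq_sym H)). assert (0 < PI / 2 * w) by (apply Rmult_lt_0_compat; lra).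
    apply Rmult_le_compat_l; [lra|]. apply Rmult_le_compat_l; lra. }
  apply Rmult_le_reg_l with (PI * PI / 2); [nra|].
  replace (PI * PI / 2 * (1 / PI)) with (PI / 2) by (field; lra).
  simpl pow; lra.
Qed.

Lemma is_lim_seq_wallis : is_lim_seq (fun n => INR n * wallis n ^ 2) (1 / PI).
Proof.
  pose proof PI_RGT_0 as HP.
  apply is_lim_seq_le_le with (u := fun n => 1 / PI - 1 / 2 * wallis n ^ 2) (w := fun _ => 1 / PI).
  - intros n. pose proof (wallis_upper n). pose proof (wallis_lower n). split; lra.
  - assert (H : is_lim_seq (fun n => wallis n ^ 2) 0).
    { apply is_lim_seq_le_le_loc with (u := fun _ => 0) (w := fun n => (1 / PI) * / INR n).
      - exists 1%nat. intros n Hn. split; [apply pow_le; left; apply wallis_pos|].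
        pose proof (wallis_upper n). assert (0 < INR n) by (apply lt_0_INR; lia).
        apply Rmult_le_reg_l with (INR n); [lra|].
        replace (INR n * (1 / PI * / INR n)) with (1 / PI) by (field; lra). lra.
      - apply is_lim_seq_const.
      - replace (Finite 0) with (Rbar_mult (1 / PI) 0) by (simpl; f_equal; ring).
        apply is_lim_seq_scal_l.
        replace (Finite 0) with (Rbar_inv p_infty) by reflexivity.
        apply is_lim_seq_inv; [apply is_lim_seq_INR|discriminate]. }
    replace (Finite (1 / PI)) with (Finite (1 / PI - 1 / 2 * 0)) by (f_equal; ring).
    apply (is_lim_seq_minus' (fun _ => 1 / PI) (fun n => 1 / 2 * wallis n ^ 2));
      [apply is_lim_seq_const|].
    apply (is_lim_seq_scal_l (fun n => wallis n ^ 2) (1 / 2) 0 H).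
  - apply is_lim_seq_const.
Qed.

(** Duplication: [(1/2)_(2n) = 4^n (1/4)_n (3/4)_n] and
    [(1)_(2n) = 4^n (1/2)_n (1)_n]. *)
Lemma hyp_coef_wallis (n : nat) :
  hyp_coef (1 / 4) (3 / 4) n = wallis n * wallis (2 * n).
Proof.
  assert (H : forall n, pochhammer (1 / 2) (2 * n)
    = 4 ^ n * (pochhammer (1 / 4) n * pochhammer (3 / 4) n)).
  { clear; induction n as [|n IH]; [simpl; ring|].
    replace (2 * S n)%nat with (S (S (2 * n))) by lia. simpl pochhammer. simpl pow.
    change (n + (n + 0))%nat with (2 * n)%nat. rewrite IH.
    change (match (2 * n)%nat with O => 1 | S _ => INR (2 * n) + 1 end) with (INR (S (2 * n))).
    rewrite S_INR, mult_INR. change (INR 2) with 2. field. }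
  assert (H1 : forall n, pochhammer 1 (2 * n)
    = 4 ^ n * (pochhammer (1 / 2) n * pochhammer 1 n)).
  { clear; induction n as [|n IH]; [simpl; ring|].
    replace (2 * S n)%nat with (S (S (2 * n))) by lia. simpl pochhammer. simpl pow.
    change (n + (n + 0))%nat with (2 * n)%nat. rewrite IH.
    change (match (2 * n)%nat with O => 1 | S _ => INR (2 * n) + 1 end) with (INR (S (2 * n))).
    rewrite S_INR, mult_INR. change (INR 2) with 2. field. }
  unfold hyp_coef, wallis. rewrite H, H1.
  assert (0 < pochhammer 1 n) by (apply pochhammer_pos; lra).
  assert (0 < pochhammer (1 / 2) n) by (apply pochhammer_pos; lra).
  assert (0 < 4 ^ n) by (apply pow_lt; lra).
  field. repeat split; lra.
Qed.

Lemma is_lim_seq_theta_hyp_coef :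
  is_lim_seq (theta (hyp_coef (1 / 4) (3 / 4))) (1 / (sqrt 2 * PI)).
Proof.
  pose proof PI_RGT_0 as HP. assert (H2 : 0 < sqrt 2) by (apply sqrt_lt_R0; lra).
  assert (Hsub : is_lim_seq (fun n => INR (2 * n) * wallis (2 * n) ^ 2) (1 / PI)).
  { apply (is_lim_seq_subseq (fun n => INR n * wallis n ^ 2) (1 / PI) (fun n => (2 * n)%nat)).
    - apply eventually_subseq. intros n; lia.
    - apply is_lim_seq_wallis. }
  assert (Hsq : is_lim_seq (fun n => (INR n * wallis n ^ 2) * (INR (2 * n) * wallis (2 * n) ^ 2))
     (1 / PI * (1 / PI))).
  { apply is_lim_seq_mult'; [apply is_lim_seq_wallis|exact Hsub]. }
  apply is_lim_seq_ext with
    (fun n => / sqrt 2 * sqrt ((INR n * wallis n ^ 2) * (INR (2 * n) * wallis (2 * n) ^ 2))).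
  - intros n. unfold theta. rewrite hyp_coef_wallis, mult_INR. change (INR 2) with 2.
    pose proof (pos_INR n). pose proof (wallis_pos n). pose proof (wallis_pos (2 * n)).
    replace (INR n * wallis n ^ 2 * (2 * INR n * wallis (2 * n) ^ 2))
      with (2 * (INR n * (wallis n * wallis (2 * n))) ^ 2) by ring.
    rewrite sqrt_mult; [|lra|apply pow2_ge_0].
    rewrite sqrt_pow2; [field; lra|]. apply Rmult_le_pos; [lra|]. apply Rmult_le_pos; lra.
  - replace (1 / (sqrt 2 * PI)) with (/ sqrt 2 * sqrt (1 / PI * (1 / PI))).
    + apply (is_lim_seq_scal_l _ (/ sqrt 2) (sqrt (1 / PI * (1 / PI)))).
      apply is_lim_seq_continuous; [|exact Hsq].
      apply continuity_pt_sqrt. apply Rmult_le_pos; left; apply Rdiv_lt_0_compat; lra.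
    + rewrite sqrt_square; [field; lra|]. left; apply Rdiv_lt_0_compat; lra.
Qed.

(** Multiplying by [1 - y] turns [u] into the sequence of its increments, whose
    series converges to [l]; Abel's theorem applies to the latter. *)
Lemma abel_limit (u : nat -> R) (l : R) :
  is_lim_seq u l ->
  filterlim (fun y => (1 - y) * PSeries u y) (at_left 1) (locally l).
Proof.
  intros Hu.
  destruct (filterlim_bounded u (ex_intro _ l Hu)) as [M HM].
  set (v := PS_minus u (PS_incr_1 u)).
  assert (Hsum : forall n, sum_n v n = u n).
  { induction n as [|n IH].
    - rewrite sum_O. assert (E : u O + - 0 = u O) by ring. exact E.
    - rewrite sum_Sn, IH. assert (E : u n + (u (S n) + - u n) = u (S n)) by ring. exact E. }
  assert (Hv : is_series v l).
  { apply filterlim_ext with (f := u); [intros n; symmetry; apply Hsum|exact Hu]. }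
  assert (Hv1 : is_pseries v 1 l).
  { apply is_pseries_R. apply is_series_ext with (2 := Hv). intros n. rewrite pow1. symmetry; apply Rmult_1_r. }
  assert (Hrad : Rbar_le 1 (CV_radius v)).
  { apply Rbar_not_lt_le. intros Hlt. apply (CV_disk_outside v 1).
    - rewrite Rabs_R1; exact Hlt.
    - apply is_lim_seq_ext with v; [intros n; rewrite pow1; symmetry; apply Rmult_1_r|].
      apply ex_series_lim_0. now exists l. }
  assert (Hlim : filterlim (PSeries v) (at_left 1) (locally l)).
  { replace l with (PSeries v 1) by (apply is_pseries_unique; exact Hv1).
    destruct (Rbar_le_lt_or_eq_dec _ _ Hrad) as [Hlt|Heq].
    - apply (filterlim_filter_le_1 _ (filter_le_within (F := locally 1) _)).
      apply continuity_pt_filterlim, PSeries_continuity. now rewrite Rabs_R1.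
    - pose proof (Abel v) as HA. rewrite <- Heq in HA. apply HA.
      + simpl; lra.
      + exact I.
      + now exists l. }
  apply filterlim_ext_loc with (2 := Hlim).
  exists (mkposreal 1 Rlt_0_1). intros y Hy Hy1.
  assert (Hy' : Rabs (y - 1) < 1) by exact Hy. apply Rabs_lt_between in Hy'.
  assert (Hex : ex_pseries u y).
  { apply CV_radius_inside, bounded_in_disk with M; [exact HM|].
    rewrite Rabs_pos_eq; lra. }
  unfold v. rewrite PSeries_minus; [|exact Hex|now apply ex_pseries_incr_1].
  rewrite PSeries_incr_1. ring.
Qed.

(** * Clausen's formula *)

Lemma sum_f_R0_rev (f : nat -> R) (n : nat) :
  sum_f_R0 f n = sum_f_R0 (fun k => f (n - k)%nat) n.
Proof.
  induction n as [|n IH] in f |- *; [reflexivity|].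
  rewrite (decomp_sum f (S n)) by lia. simpl pred. rewrite (IH (fun i => f (S i))).
  rewrite tech5. rewrite PeanoNat.Nat.sub_diag, Rplus_comm. f_equal.
  apply sum_eq. intros i Hi. f_equal. lia.
Qed.

Lemma PS_mult_sym (x y : nat -> R) (n : nat) : PS_mult x y n = PS_mult y x n.
Proof.
  unfold PS_mult. rewrite sum_f_R0_rev. apply sum_eq. intros i Hi.
  replace (n - (n - i))%nat with i by lia. ring.
Qed.

(** [theta] is a derivation for the Cauchy product. *)
Lemma theta_PS_mult (x y : nat -> R) (n : nat) :
  INR n * PS_mult x y n = PS_mult (theta x) y n + PS_mult x (theta y) n.
Proof.
  unfold PS_mult. rewrite scal_sum, <- sum_plus. apply sum_eq. intros i Hi.
  unfold theta. rewrite minus_INR by exact Hi. ring.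
Qed.

Lemma PS_mult_shift (x x' y : nat -> R) (n : nat) :
  x O = 0 -> (forall k, x (S k) = x' k) -> PS_mult x y (S n) = PS_mult x' y n.
Proof.
  intros H0 HS. unfold PS_mult. rewrite (decomp_sum _ (S n)) by lia. rewrite H0. simpl pred.
  rewrite Rmult_0_l, Rplus_0_l. apply sum_eq. intros i _. rewrite HS. reflexivity.
Qed.

Lemma PS_mult_lin (p q : R) (x y z : nat -> R) (n : nat) :
  PS_mult (fun k => p * x k + q * y k) z n = p * PS_mult x z n + q * PS_mult y z n.
Proof.
  unfold PS_mult. rewrite !scal_sum, <- sum_plus. apply sum_eq. intros i _. ring.
Qed.

Definition hyp3_coef (n : nat) : R :=
  pochhammer (1 / 3) n * pochhammer (1 / 2) n * pochhammer (2 / 3) n / (pochhammer 1 n) ^ 3.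

(** The square of a solution of a second order equation satisfies a third order
    one.  Here [g], [e = theta g] and [w = theta e] are the coefficients of the
    solution and of its two derivatives; the derivation rule expresses
    [theta ^ k] of the square by their products, and the hypergeometric
    recurrence says that [w] is the shift of a combination of [g], [e], [w]. *)
Lemma clausen_step (n : nat) :
  let s := PS_mult (hyp_coef (1 / 6) (1 / 3)) (hyp_coef (1 / 6) (1 / 3)) in
  (INR n + 1) ^ 3 * s (S n) = (INR n + 1 / 3) * (INR n + 1 / 2) * (INR n + 2 / 3) * s n.
Proof.
  set (g := hyp_coef (1 / 6) (1 / 3)). set (e := theta g). set (w := theta e). intros s.
  assert (E : forall n, INR n ^ 3 * s n = 6 * PS_mult w e n + 2 * PS_mult (theta w) g n /\
     INR n ^ 2 * s n = 2 * PS_mult e e n + 2 * PS_mult w g n /\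
     INR n * s n = 2 * PS_mult e g n).
  { intros k. pose proof (theta_PS_mult g g k) as H1. fold s e in H1.
    rewrite (PS_mult_sym g e) in H1.
    pose proof (theta_PS_mult e g k) as H2. fold e w in H2.
    pose proof (theta_PS_mult e e k) as H3. fold w in H3. rewrite (PS_mult_sym e w) in H3.
    pose proof (theta_PS_mult w g k) as H4. fold e in H4.
    assert (Q1 : INR k * s k = 2 * PS_mult e g k) by lra.
    assert (Q2 : INR k ^ 2 * s k = 2 * PS_mult e e k + 2 * PS_mult w g k).
    { replace (INR k ^ 2 * s k) with (INR k * (INR k * s k)) by ring. rewrite Q1. lra. }
    split; [|split; assumption].
    replace (INR k ^ 3 * s k) with (INR k * (INR k ^ 2 * s k)) by ring. rewrite Q2. lra. }
  set (w1 := fun k => 1 * w k + 1 * (1 / 2 * e k + 1 / 18 * g k)).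
  set (w2 := fun k => 1 * theta w k + 1 * (3 / 2 * w k + 1 * (5 / 9 * e k + 1 / 18 * g k))).
  assert (W0 : w O = 0) by (unfold w, theta; simpl; ring).
  assert (W1 : forall k, w (S k) = w1 k).
  { intros k. pose proof (hyp_coef_succ (1 / 6) (1 / 3) k) as H. fold g in H.
    unfold w1, w, e, theta. rewrite S_INR. lra. }
  assert (W2 : forall k, theta w (S k) = w2 k).
  { intros k. change (INR (S k) * w (S k) = w2 k). rewrite W1, S_INR. unfold w1, w2, w, e, theta. field. }
  destruct (E (S n)) as (E1 & _). destruct (E n) as (F3 & F2 & F1).
  rewrite S_INR, (PS_mult_shift w w1 e n W0 W1),
    (PS_mult_shift (theta w) w2 g n) in E1; [|unfold theta; simpl; ring|exact W2].
  unfold w1, w2 in E1. rewrite !PS_mult_lin in E1. rewrite (PS_mult_sym g e) in E1.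
  rewrite E1.
  replace ((INR n + 1 / 3) * (INR n + 1 / 2) * (INR n + 2 / 3) * s n) with
    (INR n ^ 3 * s n + 3 / 2 * (INR n ^ 2 * s n) + 13 / 18 * (INR n * s n) + 1 / 9 * s n) by field.
  rewrite F3, F2, F1. unfold s. lra.
Qed.

(** Clausen's formula, 2F1(1/6,1/3;1)^2 = 3F2(1/3,1/2,2/3;1,1), on coefficients. *)
Lemma clausen (n : nat) :
  PS_mult (hyp_coef (1 / 6) (1 / 3)) (hyp_coef (1 / 6) (1 / 3)) n = hyp3_coef n.
Proof.
  induction n as [|n IH].
  - unfold PS_mult, hyp3_coef, hyp_coef; simpl; field.
  - pose proof (clausen_step n) as H. simpl in H. rewrite IH in H.
    pose proof (pos_INR n). pose proof (pochhammer_pos 1 n Rlt_0_1).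
    apply Rmult_eq_reg_l with ((INR n + 1) ^ 3); [|apply pow_nonzero; lra].
    simpl pow. rewrite H. unfold hyp3_coef. simpl pochhammer. field. split; lra.
Qed.

Lemma is_series_hyp3 (z A B : R) : Rabs z < 1 ->
  is_series (fun n => hyp3_coef n * z ^ n * (A + B * INR n))
    (A * hyp (1 / 6) (1 / 3) z ^ 2
     + B * (2 * (hyp (1 / 6) (1 / 3) z * hyp_theta (1 / 6) (1 / 3) z))).
Proof.
  intros Hz. set (g := hyp_coef (1 / 6) (1 / 3)).
  assert (Hr : Rbar_lt (Rabs z) (CV_radius g)) by (apply hyp_in_disk; lra).
  assert (Hr' : Rbar_lt (Rabs z) (CV_radius (theta g))) by now rewrite CV_radius_theta.
  assert (P : forall u, Rbar_lt (Rabs z) (CV_radius u) -> is_pseries u z (PSeries u z)).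
  { intros u Hu. apply PSeries_correct, CV_radius_inside, Hu. }
  pose proof (is_pseries_mult _ _ _ _ _ (P g Hr) (P g Hr) Hr Hr) as H1.
  pose proof (is_pseries_mult _ _ _ _ _ (P g Hr) (P _ Hr') Hr Hr') as H2.
  fold (hyp (1 / 6) (1 / 3) z) (hyp_theta (1 / 6) (1 / 3) z) in H1, H2.
  apply is_pseries_R in H1. apply is_pseries_R in H2.
  pose proof (is_series_plus _ _ _ _ (is_series_scal_l A _ _ H1)
     (is_series_scal_l (2 * B) _ _ H2)) as H.
  set (G := hyp (1 / 6) (1 / 3) z) in *. set (E := hyp_theta (1 / 6) (1 / 3) z) in *.
  replace (A * G ^ 2 + B * (2 * (G * E))) with (A * (G * G) + 2 * B * (G * E)) by ring.
  apply is_series_ext with (2 := H). intros n.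
  change (A * (PS_mult g g n * z ^ n) + 2 * B * (PS_mult g (theta g) n * z ^ n)
    = hyp3_coef n * z ^ n * (A + B * INR n)).
  rewrite <- (clausen n). fold g. pose proof (theta_PS_mult g g n) as T.
  rewrite (PS_mult_sym (theta g)) in T.
  transitivity (A * PS_mult g g n * z ^ n + B * (INR n * PS_mult g g n) * z ^ n);
    [rewrite T|]; ring.
Qed.

(** * Legendre systems and the Wronskian *)

(** The equation [(x (1 - x) F')' = c F] at the point [x], written as a first
    order system; the flux [Phi] stands for [x (1 - x) F'] and stays regular at
    the singular points. *)
Definition legendre_at (c : R) (F Phi : R -> R) (x : R) : Prop :=
  exists dF, is_derive F x dF /\ x * (1 - x) * dF = Phi x /\ is_derive Phi x (c * F x).

Definition hyp_flux (a b x : R) : R := (1 - x) * hyp_theta a b x.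

Lemma hyp_legendre (a b x : R) : 0 < a -> 0 < b -> a + b = 1 -> Rabs x < 1 ->
  legendre_at (a * b) (hyp a b) (hyp_flux a b) x.
Proof.
  intros Ha Hb Hab Hx.
  destruct (hyp_system a b x) as (dF & dE & H1 & H2 & H3 & H4); try lra.
  exists dF. split; [exact H1|]. split; [unfold hyp_flux; rewrite <- H2; ring|].
  unfold hyp_flux. auto_derive; [now exists dE|].
  replace (Derive (fun x0 => hyp_theta a b x0) x) with dE by (symmetry; apply is_derive_unique; exact H3).
  rewrite Hab in H4. lra.
Qed.

(** Composition with [4 x (1 - x)] turns the equation with [a + b = 1 / 2] into
    one of Legendre type, because [1 - 4 x (1 - x) = (1 - 2 x) ^ 2]. *)
Definition hyp_quad (a b x : R) : R := hyp a b (4 * x * (1 - x)).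
Definition hyp_quad_flux (a b x : R) : R := (1 - 2 * x) * hyp_theta a b (4 * x * (1 - x)).

Lemma hyp_quad_legendre (a b x : R) : 0 < a -> 0 < b -> a + b = 1 / 2 ->
  Rabs (4 * x * (1 - x)) < 1 ->
  legendre_at (4 * (a * b)) (hyp_quad a b) (hyp_quad_flux a b) x.
Proof.
  intros Ha Hb Hab Hx.
  destruct (hyp_system a b (4 * x * (1 - x))) as (dF & dE & H1 & H2 & H3 & H4); try lra.
  exists (4 * (1 - 2 * x) * dF). split; [|split].
  - unfold hyp_quad. auto_derive; [now exists dF|].
    change (1 + - x) with (1 - x).
    replace (Derive (fun x0 => hyp a b x0) (4 * x * (1 - x))) with dF
      by (symmetry; apply is_derive_unique; exact H1). ring.
  - unfold hyp_quad_flux. rewrite <- H2. ring.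
  - unfold hyp_quad_flux, hyp_quad. auto_derive; [now exists dE|].
    change (1 + - x) with (1 - x).
    replace (Derive (fun x0 => hyp_theta a b x0) (4 * x * (1 - x))) with dE
      by (symmetry; apply is_derive_unique; exact H3).
    rewrite Hab in H4.
    replace (4 * (a * b) * hyp a b (4 * x * (1 - x))) with
      (4 * ((1 - 4 * x * (1 - x)) * dE) - 2 * hyp_theta a b (4 * x * (1 - x))) by lra.
    ring.
Qed.

Lemma const_of_derive_0 (f : R -> R) (a b : R) : a <= b ->
  (forall x, a <= x <= b -> continuity_pt f x) ->
  (forall x, a < x < b -> is_derive f x 0) -> f a = f b.
Proof.
  intros Hab Hc Hd.
  destruct (MVT_gen f a b (fun _ => 0)) as (c & _ & Hf).
  - intros x Hx. apply Hd. now rewrite Rmin_left, Rmax_right in Hx by exact Hab.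
  - intros x Hx. apply Hc. now rewrite Rmin_left, Rmax_right in Hx by exact Hab.
  - lra.
Qed.

Lemma is_derive_continuity (f : R -> R) (x l : R) : is_derive f x l -> continuity_pt f x.
Proof.
  intros H. apply continuity_pt_filterlim.
  apply (ex_derive_continuous (K := R_AbsRing) (V := R_NormedModule)). now exists l.
Qed.

Definition wronskian (F Phi : R -> R) (x : R) : R := F x * Phi (1 - x) + F (1 - x) * Phi x.

Lemma wronskian_derive (c : R) (F Phi : R -> R) (x : R) :
  legendre_at c F Phi x -> legendre_at c F Phi (1 - x) ->
  is_derive (wronskian F Phi) x 0.
Proof.
  intros (dF & H1 & H2 & H3) (dF' & H1' & H2' & H3').
  unfold wronskian. auto_derive; [repeat split; eexists; eassumption|].
  replace (Derive (fun y => F y) x) with dF by (symmetry; now apply is_derive_unique).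
  replace (Derive (fun y => F y) (1 + - x)) with dF' by (symmetry; now apply is_derive_unique).
  replace (Derive (fun y => Phi y) x) with (c * F x) by (symmetry; now apply is_derive_unique).
  replace (Derive (fun y => Phi y) (1 + - x)) with (c * F (1 - x)) by (symmetry; now apply is_derive_unique).
  change (1 + - x) with (1 - x). rewrite <- H2, <- H2'. ring.
Qed.

Lemma wronskian_const (c : R) (F Phi : R -> R) (x y : R) :
  (forall x, Rabs x < 1 -> legendre_at c F Phi x) -> 0 < x <= y -> y < 1 ->
  wronskian F Phi x = wronskian F Phi y.
Proof.
  intros H Hx Hy.
  assert (Hd : forall z, x <= z <= y -> is_derive (wronskian F Phi) z 0).
  { intros z Hz. apply wronskian_derive with c; apply H; rewrite Rabs_pos_eq; lra. }
  apply const_of_derive_0; [lra| |].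
  - intros z Hz. apply is_derive_continuity with 0, Hd, Hz.
  - intros z Hz. apply Hd; lra.
Qed.

(** The constant is read off at [y -> 1]: there [Phi y] tends to the limit of
    [n] times the coefficients, [F (1 - y)] to 1, and in the other term the
    logarithmic growth of [F y] is beaten by the factor [1 - y] in
    [Phi (1 - y)]. *)
Lemma hyp_wronskian (x : R) : 0 < x < 1 ->
  wronskian (hyp (1 / 4) (3 / 4)) (hyp_flux (1 / 4) (3 / 4)) x = 1 / (sqrt 2 * PI).
Proof.
  intros Hx. set (F := hyp _ _). set (Phi := hyp_flux _ _).
  assert (HL : forall x, Rabs x < 1 -> legendre_at (1 / 4 * (3 / 4)) F Phi x)
    by (intros; apply hyp_legendre; lra || assumption).
  set (y := fun n : nat => 1 - (1 - x) * / (INR n + 1)).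
  assert (Hy : forall n, x <= y n < 1).
  { intros n. unfold y. pose proof (pos_INR n).
    assert (0 < / (INR n + 1) <= 1).
    { split; [apply Rinv_0_lt_compat; lra|]. rewrite <- Rinv_1. apply Rinv_le_contravar; lra. }
    split; nra. }
  assert (Hinv : is_lim_seq (fun n => / (INR n + 1)) 0).
  { replace (Finite 0) with (Rbar_inv p_infty) by reflexivity.
    apply is_lim_seq_inv; [|discriminate].
    apply is_lim_seq_ext with (fun n => INR (S n)); [intros; apply S_INR|].
    apply -> (is_lim_seq_incr_1 INR). apply is_lim_seq_INR. }
  assert (Hy1 : is_lim_seq y 1).
  { replace 1 with (1 - (1 - x) * 0) by ring. unfold y.
    apply (is_lim_seq_minus' (fun _ => 1) (fun n => (1 - x) * / (INR n + 1)));
      [apply is_lim_seq_const|]. now apply (is_lim_seq_scal_l _ (1 - x) 0). }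
  assert (Hyl : filterlim y eventually (at_left 1)).
  { intros P HP. unfold at_left, within in HP. apply Hy1 in HP. unfold filtermap in *.
    revert HP. apply filter_imp. intros n Hn. apply Hn, Hy. }
  assert (Hcoef0 : is_lim_seq (hyp_coef (1 / 4) (3 / 4)) 0).
  { apply is_lim_seq_ext_loc with
      (fun n => theta (hyp_coef (1 / 4) (3 / 4)) n * / INR n).
    - exists 1%nat. intros n Hn. assert (0 < INR n) by (apply lt_0_INR; lia).
      unfold theta. field. lra.
    - replace (Finite 0) with (Finite (1 / (sqrt 2 * PI) * 0)) by (f_equal; ring).
      apply is_lim_seq_mult'; [apply is_lim_seq_theta_hyp_coef|].
      replace (Finite 0) with (Rbar_inv p_infty) by reflexivity.
      apply is_lim_seq_inv; [apply is_lim_seq_INR|discriminate]. }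
  assert (HA0 : is_lim_seq (fun n => (1 - y n) * F (y n)) 0).
  { apply (filterlim_comp _ _ _ y (fun y => (1 - y) * F y) _ _ _ Hyl).
    apply abel_limit, Hcoef0. }
  assert (HA1 : is_lim_seq (fun n => Phi (y n)) (1 / (sqrt 2 * PI))).
  { apply (filterlim_comp _ _ _ y Phi _ _ _ Hyl).
    apply (abel_limit (theta (hyp_coef (1 / 4) (3 / 4)))), is_lim_seq_theta_hyp_coef. }
  assert (Hy0 : is_lim_seq (fun n => 1 - y n) 0).
  { replace 0 with (1 - 1) by ring. apply is_lim_seq_minus'; [apply is_lim_seq_const|exact Hy1]. }
  assert (HF1 : is_lim_seq (fun n => F (1 - y n)) (F 0)).
  { apply is_lim_seq_continuous; [|exact Hy0].
    destruct (HL 0) as (d & Hd & _); [rewrite Rabs_R0; lra|].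
    apply is_derive_continuity with d, Hd. }
  set (dF := PSeries (PS_derive (hyp_coef (1 / 4) (3 / 4)))).
  assert (HdF : is_lim_seq (fun n => dF (1 - y n)) (dF 0)).
  { apply is_lim_seq_continuous; [|exact Hy0]. apply PSeries_continuity.
    rewrite CV_radius_derive. apply hyp_in_disk; try lra. rewrite Rabs_R0; lra. }
  assert (Hw : is_lim_seq (fun n => wronskian F Phi (y n))
    (0 * (1 * dF 0) + F 0 * (1 / (sqrt 2 * PI)))).
  { apply is_lim_seq_ext with (fun n => (1 - y n) * F (y n) * (y n * dF (1 - y n))
      + F (1 - y n) * Phi (y n)).
    - intros n. unfold wronskian. f_equal. unfold Phi, hyp_flux, hyp_theta.
      rewrite PSeries_theta. fold (dF (1 - y n)). ring.
    - apply is_lim_seq_plus'; apply is_lim_seq_mult'; try assumption.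
      now apply is_lim_seq_mult'. }
  assert (Hw' : is_lim_seq (fun n => wronskian F Phi (y n)) (wronskian F Phi x)).
  { apply is_lim_seq_ext with (fun _ => wronskian F Phi x); [|apply is_lim_seq_const].
    intros n. apply wronskian_const with (1 / 4 * (3 / 4)); auto; specialize (Hy n); lra. }
  apply is_lim_seq_unique in Hw. apply is_lim_seq_unique in Hw'.
  rewrite Hw in Hw'. injection Hw'. intros E. rewrite <- E.
  unfold F; rewrite hyp_0. ring.
Qed.

(** * Modular transformations from differential equations *)

(** Rewrites the derivatives left by [auto_derive] with the known ones. *)
Ltac use_derivatives :=
  repeat match goal with
  | H : is_derive ?f ?x ?l |- context [Derive (fun y => ?f y) ?x] =>
      change (Derive (fun y => f y) x) with (Derive f x);
      rewrite (is_derive_unique f x l H)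
  end.

Lemma mult_1_minus_neq_0 (x : R) : x * (1 - x) <> 0 -> x <> 0 /\ 1 - x <> 0.
Proof. intros H. split; intros E; apply H; rewrite E; ring. Qed.

(** Let [m = sqrt rho].  If [m * G (be t)] satisfies the equation of [F (al t)]
    then the flux of the former, computed with the variable [al], is
    [V = L * m * G (be t) + kappa / m * Psi (be t)], where [L] is the flux factor
    of the logarithmic derivative of [m].  The first identity of the last
    hypothesis makes this flux have that shape, the second one defines [L], and
    the third one is the differential equation.  The Wronskian
    [W = Phi (al t) * m * G (be t) - F (al t) * V] is then constant and vanishes
    at [t = 0], so the quotient of the two functions is constant; the vanishing
    of [W] at [T] is the relation between the fluxes.  Near [t = 0] the first
    identity forces [kappa] to be the order of [be] divided by that of [al]. *)
Lemma modular_transformation (c1 c2 kappa T : R) (F Phi G Psi : R -> R)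
  (al dal be dbe rho drho L dL : R -> R) :
  0 < T ->
  F 0 = 1 -> Phi 0 = 0 -> G 0 = 1 -> Psi 0 = 0 ->
  (forall t, 0 <= t <= T ->
     legendre_at c1 F Phi (al t) /\ legendre_at c2 G Psi (be t) /\ 0 < G (be t)) ->
  (forall t, 0 <= t <= T ->
     is_derive al t (dal t) /\ is_derive be t (dbe t) /\
     is_derive rho t (drho t) /\ is_derive L t (dL t) /\ 0 < rho t) ->
  al 0 = 0 -> be 0 = 0 -> rho 0 = 1 -> L 0 = 0 ->
  (forall t, 0 < t <= T -> al t * (1 - al t) <> 0 /\ be t * (1 - be t) <> 0) ->
  (forall t, 0 < t <= T ->
     al t * (1 - al t) * rho t * dbe t = kappa * (be t * (1 - be t)) * dal t /\
     2 * L t * dal t * rho t = al t * (1 - al t) * drho t /\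
     dL t + L t * drho t / (2 * rho t) + kappa * c2 * dbe t / rho t = c1 * dal t) ->
  F (al T) = sqrt (rho T) * G (be T) /\
  Phi (al T) = L T * F (al T) + kappa / sqrt (rho T) * Psi (be T).
Proof.
  intros HT F0 Phi0 G0 Psi0 Hsys Hder al0 be0 rho0 L0 Hnz Hid.
  set (m := fun t => sqrt (rho t)).
  assert (Hm : forall t, 0 <= t <= T -> 0 < m t /\ m t * m t = rho t).
  { intros t Ht. destruct (Hder t Ht) as (_ & _ & _ & _ & Hr). split.
    - apply sqrt_lt_R0, Hr.
    - apply sqrt_sqrt; lra. }
  assert (Hdm : forall t, 0 <= t <= T -> is_derive m t (drho t / (2 * m t))).
  { intros t Ht. destruct (Hder t Ht) as (_ & _ & Hr & _ & Hp).
    unfold m. auto_derive; [split; [now exists (drho t)|split; [exact Hp|exact I]]|].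
    use_derivatives. field. apply Rgt_not_eq, sqrt_lt_R0, Hp. }
  (* Away from 0 everything is expressed with the logarithmic derivative [k] of
     [al / (1 - al)]. *)
  assert (Hflow : forall t, 0 < t <= T -> exists k,
     drho t = 2 * (m t * m t) * (L t * k) /\
     c1 * dal t = dL t + L t * (L t * k) + kappa * c2 * dbe t / (m t * m t) /\
     (forall d, al t * (1 - al t) * d = Phi (al t) -> d * dal t = k * Phi (al t)) /\
     (forall d, be t * (1 - be t) * d = Psi (be t) ->
        d * dbe t = kappa / (m t * m t) * k * Psi (be t))).
  { intros t Ht. destruct (Hid t Ht) as (I1 & I2 & I3). destruct (Hnz t Ht) as (Na & Nb).
    destruct (Hm t ltac:(lra)) as (Hm1 & Hm2).
    apply mult_1_minus_neq_0 in Na. apply mult_1_minus_neq_0 in Nb.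
    assert (Hr : drho t = 2 * (m t * m t) * (L t * (dal t / (al t * (1 - al t))))).
    { transitivity (al t * (1 - al t) * drho t / (al t * (1 - al t)));
        [field; tauto|]. rewrite <- I2, Hm2. field; tauto. }
    exists (dal t / (al t * (1 - al t))). split; [exact Hr|]. repeat split.
    - rewrite <- I3, <- Hm2, Hr. field; repeat split; tauto || lra.
    - intros d <-. field; tauto.
    - intros d <-. rewrite Hm2.
      transitivity (d * (al t * (1 - al t) * rho t * dbe t) / (al t * (1 - al t) * rho t)).
      + rewrite <- Hm2. field; repeat split; tauto || lra.
      + rewrite I1, <- Hm2. field; repeat split; tauto || lra. }
  set (V := fun t => L t * (m t * G (be t)) + kappa / m t * Psi (be t)).
  set (W := fun t => Phi (al t) * (m t * G (be t)) - F (al t) * V t).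
  set (Q := fun t => F (al t) / (m t * G (be t))).
  assert (Hc : forall t, 0 <= t <= T -> continuity_pt W t /\ continuity_pt Q t).
  { intros t Ht. destruct (Hsys t Ht) as ((dF & S1 & _ & S3) & (dG & R1 & _ & R3) & Hg).
    destruct (Hder t Ht) as (D1 & D2 & D3 & D4 & _). destruct (Hm t Ht) as (Hm1 & _).
    pose proof (Hdm t Ht) as Dm.
    assert (EW : ex_derive W t).
    { unfold W, V. auto_derive. repeat split; try (eexists; eassumption). lra. }
    assert (EQ : ex_derive Q t).
    { unfold Q. auto_derive. repeat split; try (eexists; eassumption).
      apply Rgt_not_eq, Rmult_lt_0_compat; assumption. }
    destruct EW as [dW EW]. destruct EQ as [dQ EQ].
    split; [apply is_derive_continuity with dW|apply is_derive_continuity with dQ]; assumption. }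
  assert (HWd : forall t, 0 < t < T -> is_derive W t 0).
  { intros t Ht. assert (Ht' : 0 <= t <= T) by lra.
    destruct (Hsys t Ht') as ((dF & S1 & S2 & S3) & (dG & R1 & R2 & R3) & _).
    destruct (Hder t Ht') as (D1 & D2 & D3 & D4 & _). destruct (Hm t Ht') as (Hm1 & _).
    pose proof (Hdm t Ht') as Dm.
    destruct (Hflow t ltac:(lra)) as (k & K1 & K2 & K3 & K4).
    specialize (K3 _ S2). specialize (K4 _ R2).
    unfold W, V. auto_derive; [repeat split; try (eexists; eassumption); lra|].
    use_derivatives. rewrite K1.
    transitivity ((c1 * dal t) * (F (al t) * m t * G (be t))
      + Phi (al t) * (L t * k * m t * G (be t) + m t * (dG * dbe t))
      - ((dF * dal t) * (L t * (m t * G (be t)) + kappa / m t * Psi (be t))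
         + F (al t) * (dL t * (m t * G (be t))
             + L t * (L t * k * m t * G (be t) + m t * (dG * dbe t))
             - kappa * L t * k / m t * Psi (be t) + kappa / m t * dbe t * c2 * G (be t)))).
    - field. lra.
    - rewrite K2, K3, K4. field. lra. }
  assert (HW0 : forall t, 0 <= t <= T -> W t = 0).
  { intros t Ht. rewrite <- (const_of_derive_0 W 0 t).
    - unfold W, V. rewrite al0, be0, Phi0, L0, Psi0. ring.
    - apply Ht.
    - intros s Hs. apply Hc. lra.
    - intros s Hs. apply HWd. lra. }
  assert (HQ : Q 0 = Q T).
  { apply const_of_derive_0; [lra|intros t Ht; now apply Hc|].
    intros t Ht. assert (Ht' : 0 <= t <= T) by lra.
    destruct (Hsys t Ht') as ((dF & S1 & S2 & S3) & (dG & R1 & R2 & R3) & Hg).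
    destruct (Hder t Ht') as (D1 & D2 & _). destruct (Hm t Ht') as (Hm1 & _).
    pose proof (Hdm t Ht') as Dm.
    destruct (Hflow t ltac:(lra)) as (k & K1 & _ & K3 & K4).
    specialize (K3 _ S2). specialize (K4 _ R2).
    assert (Hv : 0 < m t * G (be t)) by (apply Rmult_lt_0_compat; assumption).
    unfold Q. auto_derive; [repeat split; try (eexists; eassumption); lra|].
    use_derivatives. rewrite K1.
    transitivity (((dF * dal t) * (m t * G (be t))
       - F (al t) * (L t * k * (m t * G (be t)) + m t * (dG * dbe t)))
       / (m t * G (be t)) ^ 2); [field; lra|].
    rewrite K3, K4.
    transitivity (k / (m t * G (be t)) ^ 2 * W t); [unfold W, V; field; lra|].
    rewrite (HW0 t Ht'). ring. }
  assert (HT' : 0 <= T <= T) by lra.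
  destruct (Hsys T HT') as (_ & _ & Hg). destruct (Hm T HT') as (Hm1 & _).
  assert (Hv : 0 < m T * G (be T)) by (apply Rmult_lt_0_compat; assumption).
  assert (Hf : F (al T) = m T * G (be T)).
  { unfold Q in HQ. rewrite al0, be0, F0, G0 in HQ. unfold m at 1 in HQ.
    rewrite rho0, sqrt_1 in HQ. apply Rmult_eq_reg_r with (/ (m T * G (be T))).
    - unfold Rdiv in HQ. rewrite <- HQ. field. lra.
    - apply Rinv_neq_0_compat; lra. }
  split; [exact Hf|].
  pose proof (HW0 T HT') as H0. unfold W, V in H0. rewrite <- Hf in H0, Hv. unfold m in H0.
  apply Rmult_eq_reg_r with (F (al T)); lra.
Qed.

(** * Four modular transformations *)

Lemma ratio_01 (U V : R) : 0 < U -> 0 < V -> 0 < U / (U + V) < 1.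
Proof.
  intros HU HV. assert (H : 0 < U / (U + V)) by (apply Rdiv_lt_0_compat; lra).
  assert (H' : 0 < V / (U + V)) by (apply Rdiv_lt_0_compat; lra).
  replace (V / (U + V)) with (1 - U / (U + V)) in H' by (field; lra). lra.
Qed.

(** The parametrisation of level 6 has its cusps at [0], [-3], [1] and [-2]: in
    each case the modulus [x] and [1 - x] have their zeros there. *)
Definition cubic_beta (p : R) : R := p ^ 2 * (3 + p) / 4.

Definition cubic_alpha (p : R) : R := p * (3 + p) ^ 2 / (2 * (1 + p) ^ 3).

Definition quartic_mod (p : R) : R := 4 * p * (p + 2) ^ 3 / (3 * (1 + 4 * p + p ^ 2) ^ 2).

Definition quartic_mod3 (p : R) : R := 4 * p ^ 3 * (p + 2) / (3 * (3 - p ^ 2) ^ 2).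

Lemma cubic_beta_01 (p : R) : 0 < p < 1 -> 0 < cubic_beta p < 1.
Proof. intros Hp. unfold cubic_beta. split; nra. Qed.

Lemma quartic_mod_01 (p : R) : 0 < p < 1 -> 0 < quartic_mod p < 1.
Proof.
  intros Hp. unfold quartic_mod.
  replace (3 * (1 + 4 * p + p ^ 2) ^ 2)
    with (4 * p * (p + 2) ^ 3 + (1 - p) ^ 3 * (3 + p)) by ring.
  apply ratio_01.
  - apply Rmult_lt_0_compat; [lra|apply pow_lt; lra].
  - apply Rmult_lt_0_compat; [apply pow_lt; lra|lra].
Qed.

Lemma quartic_mod3_01 (p : R) : 0 < p < 1 -> 0 < quartic_mod3 p < 1.
Proof.
  intros Hp. unfold quartic_mod3.
  replace (3 * (3 - p ^ 2) ^ 2)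
    with (4 * p ^ 3 * (p + 2) + (1 - p) * (3 + p) ^ 3) by ring.
  apply ratio_01.
  - apply Rmult_lt_0_compat; [|lra]. pose proof (pow_lt p 3). lra.
  - apply Rmult_lt_0_compat; [lra|apply pow_lt; lra].
Qed.

Lemma mult_1_minus_01_neq_0 (x : R) : 0 < x < 1 -> x * (1 - x) <> 0.
Proof. intros H. apply Rgt_not_eq, Rmult_lt_0_compat; lra. Qed.

Lemma extend_01 (f : R -> R) (T t : R) : f 0 = 0 -> (forall t, 0 < t <= T -> 0 < f t < 1) ->
  0 <= t <= T -> 0 <= f t < 1.
Proof.
  intros H0 H Ht. destruct (Req_dec t 0) as [->|]; [rewrite H0; lra|].
  specialize (H t ltac:(lra)). lra.
Qed.

Local Notation F4 := (hyp (1 / 4) (3 / 4)).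
Local Notation Phi4 := (hyp_flux (1 / 4) (3 / 4)).
Local Notation F3 := (hyp (1 / 3) (2 / 3)).
Local Notation Phi3 := (hyp_flux (1 / 3) (2 / 3)).

Lemma hyp_flux_0 (a b : R) : hyp_flux a b 0 = 0.
Proof. unfold hyp_flux; rewrite hyp_theta_0; ring. Qed.

Lemma legendre_F4 (x : R) : 0 <= x < 1 -> legendre_at (3 / 16) F4 Phi4 x.
Proof.
  intros H. replace (3 / 16) with (1 / 4 * (3 / 4)) by field.
  apply hyp_legendre; try lra. rewrite Rabs_pos_eq; lra.
Qed.

Lemma legendre_F3 (x : R) : 0 <= x < 1 -> legendre_at (2 / 9) F3 Phi3 x.
Proof.
  intros H. replace (2 / 9) with (1 / 3 * (2 / 3)) by field.
  apply hyp_legendre; try lra. rewrite Rabs_pos_eq; lra.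
Qed.

Ltac nz := repeat match goal with
  | |- True => exact I
  | |- _ /\ _ => split
  | |- _ * _ <> 0 => apply Rmult_integral_contrapositive_currified
  | |- _ ^ _ <> 0 => apply pow_nonzero
  | |- _ <> 0 => apply Rgt_not_eq; nra
  end.

(** In this and the following transformations [rho] is the square of the
    multiplier: a quotient of two modular forms of weight 2, hence rational in
    the parameter.  Its zeros and poles are points where one of the moduli is
    infinite.  The slope is the flux factor [L] of
    [modular_transformation]. *)
Definition quartic_slope (p : R) : R :=
  p * (3 + p) * (1 - p) * (2 + p) ^ 2 / (6 * (1 + 4 * p + p ^ 2) ^ 2).

Lemma quartic_mod_transformation (p : R) : 0 < p < 1 ->
  F4 (quartic_mod p) = sqrt (1 + 4 * p + p ^ 2) * F3 (cubic_beta p) /\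
  Phi4 (quartic_mod p) = quartic_slope p * F4 (quartic_mod p)
    + 2 / sqrt (1 + 4 * p + p ^ 2) * Phi3 (cubic_beta p).
Proof.
  intros Hp.
  (* The derivative of a modulus [x] is [x * (1 - x)] times the logarithmic
     derivative of [x / (1 - x)], which explains its factored form. *)
  apply (modular_transformation (3 / 16) (2 / 9) 2 p F4 Phi4 F3 Phi3 quartic_mod
    (fun p => 8 * (p + 2) ^ 2 * (1 - p) ^ 2 / (3 * (1 + 4 * p + p ^ 2) ^ 3))
    cubic_beta (fun p => 3 * p * (p + 2) / 4)
    (fun p => 1 + 4 * p + p ^ 2) (fun p => 4 + 2 * p) quartic_slope
    (fun p => (12 + 8 * p - 27 * p ^ 2 - 24 * p ^ 3 - 5 * p ^ 4) / (6 * (1 + 4 * p + p ^ 2) ^ 2)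
      - 2 * (4 + 2 * p) * (p * (3 + p) * (1 - p) * (2 + p) ^ 2) / (6 * (1 + 4 * p + p ^ 2) ^ 3)));
    try apply hyp_0; try apply hyp_flux_0; try lra.
  - intros t Ht.
    assert (0 <= quartic_mod t < 1).
    { apply extend_01 with p; [unfold quartic_mod; field|intros s Hs; apply quartic_mod_01; lra|exact Ht]. }
    assert (0 <= cubic_beta t < 1).
    { apply extend_01 with p; [unfold cubic_beta; field|intros s Hs; apply cubic_beta_01; lra|exact Ht]. }
    split; [now apply legendre_F4|]. split; [now apply legendre_F3|]. apply hyp_pos; lra.
  - intros t Ht. assert (0 < 1 + 4 * t + t ^ 2) by nra. unfold quartic_mod, cubic_beta, quartic_slope.
    split; [|split; [|split; [|split]]]; try assumption; (auto_derive; [nz|field; nz]).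
  - unfold quartic_mod; field.
  - unfold cubic_beta; field.
  - unfold quartic_slope; field.
  - intros t Ht. split; apply mult_1_minus_01_neq_0; [apply quartic_mod_01|apply cubic_beta_01]; lra.
  - intros t Ht. assert (0 < 1 + 4 * t + t ^ 2) by nra. unfold quartic_mod, cubic_beta, quartic_slope.
    split; [|split]; field; nz.
Qed.

Definition quartic_slope3 (p : R) : R :=
  - (p ^ 2 * (3 + p) * (1 - p) * (2 + p)) / (6 * (3 - p ^ 2) ^ 2).

Lemma quartic_mod3_transformation (p : R) : 0 < p < 1 ->
  F4 (quartic_mod3 p) = sqrt ((3 - p ^ 2) / 3) * F3 (cubic_beta p) /\
  Phi4 (quartic_mod3 p) = quartic_slope3 p * F4 (quartic_mod3 p)
    + 2 / 3 / sqrt ((3 - p ^ 2) / 3) * Phi3 (cubic_beta p).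
Proof.
  intros Hp.
  apply (modular_transformation (3 / 16) (2 / 9) (2 / 3) p F4 Phi4 F3 Phi3 quartic_mod3
    (fun p => 8 * p ^ 2 * (3 + p) ^ 2 / (3 * (3 - p ^ 2) ^ 3))
    cubic_beta (fun p => 3 * p * (p + 2) / 4)
    (fun p => (3 - p ^ 2) / 3) (fun p => - 2 * p / 3) quartic_slope3
    (fun p => - (12 * p - 3 * p ^ 2 - 16 * p ^ 3 - 5 * p ^ 4) / (6 * (3 - p ^ 2) ^ 2)
      - 4 * p * (p ^ 2 * (3 + p) * (1 - p) * (2 + p)) / (6 * (3 - p ^ 2) ^ 3)));
    try apply hyp_0; try apply hyp_flux_0; try lra.
  - intros t Ht.
    assert (0 <= quartic_mod3 t < 1).
    { apply extend_01 with p; [unfold quartic_mod3; field|intros s Hs; apply quartic_mod3_01; lra|exact Ht]. }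
    assert (0 <= cubic_beta t < 1).
    { apply extend_01 with p; [unfold cubic_beta; field|intros s Hs; apply cubic_beta_01; lra|exact Ht]. }
    split; [now apply legendre_F4|]. split; [now apply legendre_F3|]. apply hyp_pos; lra.
  - intros t Ht. assert (0 < 3 - t ^ 2) by nra. unfold quartic_mod3, cubic_beta, quartic_slope3.
    split; [|split; [|split; [|split]]]; try lra; (auto_derive; [nz|field; nz]).
  - unfold quartic_mod3; field.
  - unfold cubic_beta; field.
  - unfold quartic_slope3; field.
  - intros t Ht. split; apply mult_1_minus_01_neq_0; [apply quartic_mod3_01|apply cubic_beta_01]; lra.
  - intros t Ht. assert (0 < 3 - t ^ 2) by nra. unfold quartic_mod3, cubic_beta, quartic_slope3.
    split; [|split]; field; nz.
Qed.

(** On this interval [4 * x * (1 - x)] stays in the disk of convergence. *)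
Lemma cubic_alpha_bound (s : R) : 0 < s <= 1 / 50 -> -1 / 5 < cubic_alpha (- s) < 0.
Proof.
  intros Hs. unfold cubic_alpha. replace (1 + - s) with (1 - s) by ring.
  assert (H : 0 < 2 * (1 - s) ^ 3) by (apply Rmult_lt_0_compat; [lra|apply pow_lt; lra]).
  split; apply Rmult_lt_reg_r with (2 * (1 - s) ^ 3); try exact H;
    unfold Rdiv at 2 || unfold Rdiv; rewrite ?Rmult_assoc, ?Rinv_l by lra; nra.
Qed.

Local Notation F6_quad := (hyp_quad (1 / 6) (1 / 3)).
Local Notation Phi6_quad := (hyp_quad_flux (1 / 6) (1 / 3)).

Definition cubic_slope (p : R) : R :=
  p * (3 + p) * (1 - p) * (2 + p) / (6 * (1 + p) ^ 3).

(** On the side of negative [q].  For small [x] the function 2F1(1/3,2/3;1;x)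
    coincides with 2F1(1/6,1/3;1;4x(1-x)); the second form is used for
    [x = cubic_alpha p], as it is the one whose square Clausen's formula gives. *)
Lemma cubic_alpha_transformation (p : R) : -1 / 50 <= p < 0 ->
  F6_quad (cubic_alpha p) = sqrt ((1 + p) ^ 2) * F3 (cubic_beta p) /\
  Phi6_quad (cubic_alpha p) = cubic_slope p * F6_quad (cubic_alpha p)
    + 2 / sqrt ((1 + p) ^ 2) * Phi3 (cubic_beta p).
Proof.
  intros Hp. rewrite <- (Ropp_involutive p).
  assert (Hb : forall s, 0 < s <= - p -> 0 < cubic_beta (- s) < 1)
    by (intros s Hs; unfold cubic_beta; split; nra).
  apply (modular_transformation (2 / 9) (2 / 9) 2 (- p) F6_quad Phi6_quad F3 Phi3 (fun s => cubic_alpha (- s))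
    (fun s => - (3 * (3 - s) * (1 + s) / (2 * (1 - s) ^ 4)))
    (fun s => cubic_beta (- s)) (fun s => - (3 * (- s) * (2 - s) / 4))
    (fun s => (1 + - s) ^ 2) (fun s => - (2 * (1 - s))) (fun s => cubic_slope (- s))
    (fun s => - ((6 + 2 * s - 12 * s ^ 2 + 4 * s ^ 3) / (6 * (1 - s) ^ 3)
      - 3 * ((- s) * (3 - s) * (1 + s) * (2 - s)) / (6 * (1 - s) ^ 4))));
    try apply hyp_0; try apply hyp_flux_0; try lra.
  - unfold hyp_quad. rewrite Rmult_0_r, Rmult_0_l. apply hyp_0.
  - unfold hyp_quad_flux. rewrite !Rmult_0_r, Rmult_0_l, hyp_theta_0. ring.
  - intros t Ht.
    assert (-1 / 5 < cubic_alpha (- t) <= 0).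
    { destruct (Req_dec t 0) as [->|]; [rewrite Ropp_0; unfold cubic_alpha; lra|].
      pose proof (cubic_alpha_bound t). lra. }
    assert (0 <= cubic_beta (- t) < 1).
    { apply (extend_01 (fun s => cubic_beta (- s))) with (- p); [unfold cubic_beta; field|exact Hb|exact Ht]. }
    split; [|split; [now apply legendre_F3|apply hyp_pos; lra]].
    replace (2 / 9) with (4 * (1 / 6 * (1 / 3))) by field. apply hyp_quad_legendre; try lra.
    apply Rabs_lt_between; split; nra.
  - intros t Ht. unfold cubic_alpha, cubic_beta, cubic_slope.
    split; [|split; [|split; [|split]]]; try nra; (auto_derive; [nz|field; nz]).
  - unfold cubic_alpha. rewrite Ropp_0. field.
  - unfold cubic_beta; field.
  - unfold cubic_slope. rewrite Ropp_0. field.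
  - intros t Ht. split; [|now apply mult_1_minus_01_neq_0, Hb]. pose proof (cubic_alpha_bound t ltac:(lra)).
    apply Rmult_integral_contrapositive_currified; lra.
  - intros t Ht. unfold cubic_alpha, cubic_beta, cubic_slope.
    split; [|split]; field; nz.
Qed.

(** The cusps of the level 10 parametrisation are [0], [1 / 4], [-1] and
    infinity: [x / (1 - x)] is [64 t (1 + t)^5 / (1 - 4 t)^5] for the first
    modulus and [64 t^5 (1 + t) / (1 - 4 t)] for the second. *)
Definition quintic_alpha (t : R) : R :=
  64 * t * (1 + t) ^ 5 / ((1 + 4 * t ^ 2) * (1 + 22 * t - 4 * t ^ 2) ^ 2).

Definition quintic_beta (t : R) : R :=
  64 * t ^ 5 * (1 + t) / ((1 + 4 * t ^ 2) * (1 - 2 * t - 4 * t ^ 2) ^ 2).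

Lemma quintic_alpha_01 (t : R) : 0 < t < 1 / 4 -> 0 < quintic_alpha t < 1.
Proof.
  intros Hp. unfold quintic_alpha.
  replace ((1 + 4 * t ^ 2) * (1 + 22 * t - 4 * t ^ 2) ^ 2)
    with (64 * t * (1 + t) ^ 5 + (1 - 4 * t) ^ 5) by ring.
  apply ratio_01.
  - apply Rmult_lt_0_compat; [lra|apply pow_lt; lra].
  - apply pow_lt; lra.
Qed.

Lemma quintic_beta_01 (t : R) : 0 < t < 1 / 4 -> 0 < quintic_beta t < 1.
Proof.
  intros Hp. unfold quintic_beta.
  replace ((1 + 4 * t ^ 2) * (1 - 2 * t - 4 * t ^ 2) ^ 2)
    with (64 * t ^ 5 * (1 + t) + (1 - 4 * t)) by ring.
  apply ratio_01.
  - apply Rmult_lt_0_compat; [|lra]. pose proof (pow_lt t 5). lra.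
  - lra.
Qed.

Definition quintic_slope (t : R) : R :=
  12 * (t * (1 + t) * (1 - 4 * t) * (1 + 4 * t ^ 2))
  / ((1 + 22 * t - 4 * t ^ 2) ^ 2 * (1 - 2 * t - 4 * t ^ 2)).

Lemma quintic_transformation (t : R) : 0 < t < 1 / 4 ->
  let rho := (1 + 22 * t - 4 * t ^ 2) / (1 - 2 * t - 4 * t ^ 2) in
  F4 (quintic_alpha t) = sqrt rho * F4 (quintic_beta t) /\
  Phi4 (quintic_alpha t) = quintic_slope t * F4 (quintic_alpha t) + 5 / sqrt rho * Phi4 (quintic_beta t).
Proof.
  intros Ht rho.
  apply (modular_transformation (3 / 16) (3 / 16) 5 t F4 Phi4 F4 Phi4 quintic_alpha
    (fun t => 64 * (1 + t) ^ 4 * (1 - 4 * t) ^ 4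
       / ((1 + 4 * t ^ 2) ^ 2 * (1 + 22 * t - 4 * t ^ 2) ^ 3))
    quintic_beta (fun t => 320 * t ^ 4 / ((1 + 4 * t ^ 2) ^ 2 * (1 - 2 * t - 4 * t ^ 2) ^ 3))
    (fun t => (1 + 22 * t - 4 * t ^ 2) / (1 - 2 * t - 4 * t ^ 2))
    (fun t => 24 * (1 + 4 * t ^ 2) / (1 - 2 * t - 4 * t ^ 2) ^ 2) quintic_slope
    (fun t => let e1 := 1 + 22 * t - 4 * t ^ 2 in let e2 := 1 - 2 * t - 4 * t ^ 2 in
      12 * (1 - 6 * t - 48 * t ^ 3 - 80 * t ^ 4) / (e1 ^ 2 * e2)
      - 12 * (t * (1 + t) * (1 - 4 * t) * (1 + 4 * t ^ 2))
        * (2 * (22 - 8 * t) / (e1 ^ 3 * e2) + (- 2 - 8 * t) / (e1 ^ 2 * e2 ^ 2))));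
    try apply hyp_0; try apply hyp_flux_0; try lra.
  - intros s Hs.
    assert (0 <= quintic_alpha s < 1).
    { apply extend_01 with t; [unfold quintic_alpha; field|intros r Hr; apply quintic_alpha_01; lra|exact Hs]. }
    assert (0 <= quintic_beta s < 1).
    { apply extend_01 with t; [unfold quintic_beta; field|intros r Hr; apply quintic_beta_01; lra|exact Hs]. }
    split; [now apply legendre_F4|]. split; [now apply legendre_F4|]. apply hyp_pos; lra.
  - intros s Hs. assert (0 < 1 + 4 * s ^ 2) by nra. assert (0 < 1 + 22 * s - 4 * s ^ 2) by nra.
    assert (0 < 1 - 2 * s - 4 * s ^ 2) by nra.
    unfold quintic_alpha, quintic_beta, quintic_slope.
    split; [|split; [|split; [|split]]]; try (apply Rdiv_lt_0_compat; assumption);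
      (auto_derive; [nz|field; nz]).
  - unfold quintic_alpha; field.
  - unfold quintic_beta; field.
  - unfold quintic_slope; field.
  - intros s Hs. split; apply mult_1_minus_01_neq_0; [apply quintic_alpha_01|apply quintic_beta_01]; lra.
  - intros s Hs. assert (0 < 1 + 4 * s ^ 2) by nra. assert (0 < 1 + 22 * s - 4 * s ^ 2) by nra.
    assert (0 < 1 - 2 * s - 4 * s ^ 2) by nra.
    unfold quintic_alpha, quintic_beta, quintic_slope.
    split; [|split]; field; nz.
Qed.

(** * The point with complex multiplication *)

(** In this part [a], [b] and [c] are the square roots of 2, 5 and 3.  The values
    of the parameters at the points of the introduction lie in the field that
    they generate: [cm_p] belongs to [tau], [cm_p'] to [tau + 1 / 2], and [cm_t]
    is the parameter of level 10 at [tau']. *)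
Definition cm_p (a b : R) : R := (2 * b - a - 3) / 3.

Definition cm_p' (a b c : R) : R := (- 6 + a - 2 * b + 2 * c + a * b * c) / 6.

Definition cm_t (a b : R) : R := (- 9 - 5 * a + 3 * b + 3 * a * b) / 4.

Lemma cm_bounds (a b c : R) : 0 < a -> 0 < b -> 0 < c -> a ^ 2 = 2 -> b ^ 2 = 5 -> c ^ 2 = 3 ->
  0 < cm_p a b < 1 /\ 0 < cm_t a b < 1 / 4 /\ - 1 / 50 <= cm_p' a b c < 0.
Proof.
  intros a0 b0 c0 Ha Hb Hc. unfold cm_p, cm_t, cm_p'.
  assert (Ba : 1.41421 < a < 1.41422) by (split; nra).
  assert (Bb : 2.23606 < b < 2.23607) by (split; nra).
  assert (Bc : 1.73205 < c < 1.73206) by (split; nra).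
  assert (Bab : 3.16227 < a * b < 3.16228).
  { assert ((a * b) ^ 2 = 10) by (rewrite Rpow_mult_distr, Ha, Hb; lra).
    assert (0 < a * b) by nra. split; nra. }
  assert (Babc : 5.47722 < a * b * c < 5.47723).
  { assert ((a * b * c) ^ 2 = 30) by (rewrite !Rpow_mult_distr, Ha, Hb, Hc; lra).
    assert (0 < a * b * c) by nra. split; nra. }
  repeat split; lra.
Qed.

Lemma div_eq (x y z : R) : y <> 0 -> x = z * y -> x / y = z.
Proof. intros Hy ->. field. exact Hy. Qed.

(** The parameters of [tau] and [tau + 1 / 2] have the same [q ^ 2]. *)
Lemma cm_cubic_beta (a b c : R) : a ^ 2 = 2 -> b ^ 2 = 5 -> c ^ 2 = 3 ->
  cubic_beta (cm_p' a b c) = cubic_beta (cm_p a b).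
Proof. intros Ha Hb Hc. unfold cubic_beta, cm_p, cm_p'. field [Ha Hb Hc]. Qed.

(** The Fricke involution of level 2 exchanges [tau] and [tau']. *)
Lemma cm_fricke (a b : R) : a ^ 2 = 2 -> b ^ 2 = 5 -> 0 < cm_p a b < 1 -> 0 < cm_t a b < 1 / 4 ->
  quintic_alpha (cm_t a b) = 1 - quartic_mod (cm_p a b).
Proof.
  intros Ha Hb Hp Ht.
  transitivity ((147 - 12 * b + 38 * a * b) / 294).
  - unfold quintic_alpha. apply div_eq; [nz|]. unfold cm_t. field [Ha Hb].
  - replace (quartic_mod (cm_p a b)) with ((147 + 12 * b - 38 * a * b) / 294); [field|].
    symmetry. unfold quartic_mod. apply div_eq; [nz|]. unfold cm_p. field [Ha Hb].
Qed.

(** [5 * tau' = 3 * tau]. *)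
Lemma cm_meet (a b : R) : a ^ 2 = 2 -> b ^ 2 = 5 -> 0 < cm_p a b < 1 -> 0 < cm_t a b < 1 / 4 ->
  quintic_beta (cm_t a b) = quartic_mod3 (cm_p a b).
Proof.
  intros Ha Hb Hp Ht.
  transitivity ((147 - 12 * b - 38 * a * b) / 294); [|symmetry].
  - unfold quintic_beta. apply div_eq; [nz|]. unfold cm_t. field [Ha Hb].
  - unfold quartic_mod3. apply div_eq; [nz|]. unfold cm_p. field [Ha Hb].
Qed.

Lemma cm_quartic_slope (a b : R) : a ^ 2 = 2 -> b ^ 2 = 5 -> 0 < cm_p a b < 1 ->
  quartic_slope (cm_p a b) = (21 + 7 * a + 22 * b + 12 * a * b) / 3528.
Proof.
  intros Ha Hb Hp. unfold quartic_slope. apply div_eq; [nz|]. unfold cm_p. field [Ha Hb].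
Qed.

Lemma cm_quartic_slope3 (a b : R) : a ^ 2 = 2 -> b ^ 2 = 5 -> 0 < cm_p a b < 1 ->
  quartic_slope3 (cm_p a b) = (21 - 7 * a - 22 * b + 12 * a * b) / 3528.
Proof.
  intros Ha Hb Hp. unfold quartic_slope3. apply div_eq; [nz|]. unfold cm_p. field [Ha Hb].
Qed.

Lemma cm_quintic_slope (a b : R) : a ^ 2 = 2 -> b ^ 2 = 5 -> 0 < cm_t a b < 1 / 4 ->
  quintic_slope (cm_t a b) = (18 * b + 27 * a * b) / 980.
Proof.
  intros Ha Hb Ht. unfold quintic_slope. apply div_eq; [nz|]. unfold cm_t. field [Ha Hb].
Qed.

Lemma cm_cubic_slope (a b c : R) : a ^ 2 = 2 -> b ^ 2 = 5 -> c ^ 2 = 3 ->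
  - 1 / 50 <= cm_p' a b c < 0 ->
  cubic_slope (cm_p' a b c) = (- 285 * a + 174 * b - 280 * c + 86 * (a * b * c)) / 1350.
Proof.
  intros Ha Hb Hc Hp. unfold cubic_slope. apply div_eq; [nz|]. unfold cm_p'. field [Ha Hb Hc].
Qed.

Lemma cm_cubic_alpha (a b c : R) : a ^ 2 = 2 -> b ^ 2 = 5 -> c ^ 2 = 3 ->
  - 1 / 50 <= cm_p' a b c < 0 ->
  cubic_alpha (cm_p' a b c) = (450 - 945 * a + 378 * b - 710 * c + 217 * (a * b * c)) / 900.
Proof.
  intros Ha Hb Hc Hp. unfold cubic_alpha. apply div_eq; [nz|]. unfold cm_p'. field [Ha Hb Hc].
Qed.

(** The second equality exhibits in the coefficient of [n] the factor [1 - 2 x]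
    that turns [z * d/dz] into the flux with respect to [x]. *)
Lemma cm_argument (a b c : R) : a ^ 2 = 2 -> b ^ 2 = 5 -> c ^ 2 = 3 ->
  - 1 / 50 <= cm_p' a b c < 0 ->
  let x := cubic_alpha (cm_p' a b c) in
  4 * x * (1 - x) = (22617 * (b * c) + 27314 * (a * b) - 36036 * (a * c) - 87049) / 3375 /\
  (63 * (b * c) + 71 * (a * b) - 63 * (a * c) - 217) / 45 = a * b * c / 3 * (1 - 2 * x).
Proof.
  intros Ha Hb Hc Hp x. unfold x. rewrite (cm_cubic_alpha a b c Ha Hb Hc Hp).
  split; field [Ha Hb Hc].
Qed.

(** The squared multipliers multiply up to [F4 (1 - X) ^ 2 / F4 X ^ 2], which is
    [5 / 3] since [tau / tau' = 5 / 3]. *)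
Lemma cm_multipliers (a b : R) : a ^ 2 = 2 -> b ^ 2 = 5 -> let p := cm_p a b in let t := cm_t a b in
  0 < t < 1 / 4 ->
  (1 + 22 * t - 4 * t ^ 2) / (1 - 2 * t - 4 * t ^ 2) * ((3 - p ^ 2) / 3)
  = 5 / 3 * (1 + 4 * p + p ^ 2).
Proof.
  intros Ha Hb p t Ht.
  assert (Hd : 0 < 1 - 2 * t - 4 * t ^ 2) by nra.
  apply Rmult_eq_reg_r with (3 * (1 - 2 * t - 4 * t ^ 2)); [|lra].
  transitivity (3 * (1 + 22 * t - 4 * t ^ 2) * ((3 - p ^ 2) / 3)); [field; lra|].
  unfold p, t, cm_p, cm_t. field [Ha Hb].
Qed.

(** The sum of the series and the Wronskian relation are both combinations of
    [g ^ 2] and [g * ps], for [g] and [ps] the values of [F3] and of its flux at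
    [cubic_beta].  This identity compares the coefficients of [g ^ 2]; those of
    [g * ps] match because of the factor found in [cm_argument]. *)
Lemma cm_constant_term (a b c : R) : a ^ 2 = 2 -> b ^ 2 = 5 -> c ^ 2 = 3 ->
  0 < cm_p a b < 1 -> 0 < cm_t a b < 1 / 4 -> - 1 / 50 <= cm_p' a b c < 0 ->
  let p := cm_p a b in let p' := cm_p' a b c in
  (1 + p') ^ 2 * ((54 * (b * c) + 68 * (a * b) - 72 * (a * c) - 193) / 135
      + 2 * (a * b * c) / 3 * cubic_slope p')
  = a * (b * c / 3 * (1 + 4 * p + p ^ 2) * (quintic_slope (cm_t a b) + quartic_slope p)
       + b * c * ((3 - p ^ 2) / 3) * quartic_slope3 p).
Proof.
  intros Ha Hb Hc Hp Ht Hp' p p'. unfold p, p'.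
  rewrite cm_cubic_slope, cm_quartic_slope, cm_quartic_slope3, cm_quintic_slope by assumption.
  unfold cm_p, cm_p'. field [Ha Hb Hc].
Qed.

(** The Wronskian of [F4] at [X = quartic_mod p].  The point [X] is reached from
    [cubic_beta p] directly, and [1 - X] through the meeting point
    [quartic_mod3 p]; the three multipliers combine into [b * c / 3]. *)
Lemma cm_quadratic_relation (a b c : R) : 0 < a -> 0 < b -> 0 < c ->
  a ^ 2 = 2 -> b ^ 2 = 5 -> c ^ 2 = 3 -> 0 < cm_p a b < 1 -> 0 < cm_t a b < 1 / 4 ->
  let p := cm_p a b in let g := F3 (cubic_beta p) in let ps := Phi3 (cubic_beta p) in
  (b * c / 3 * (1 + 4 * p + p ^ 2) * (quintic_slope (cm_t a b) + quartic_slope p)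
     + b * c * ((3 - p ^ 2) / 3) * quartic_slope3 p) * g ^ 2
  + 4 * (b * c) / 3 * (g * ps) = 1 / (sqrt 2 * PI).
Proof.
  intros a0 b0 c0 Ha Hb Hc Bp Bt p g ps. set (t := cm_t a b) in *. fold p in Bp.
  destruct (quartic_mod_transformation p Bp) as [V1 D1].
  destruct (quartic_mod3_transformation p Bp) as [V2 D2].
  destruct (quintic_transformation t Bt) as [V5 D5].
  unfold t in V5, D5. rewrite (cm_fricke a b), (cm_meet a b) in V5, D5 by assumption.
  pose proof (cm_multipliers a b Ha Hb Bt) as Hr. cbv zeta in Hr.
  fold p g in V1, V2, V5, Hr. fold p ps in D1, D2, D5. fold t in V5, D5, Hr.
  rewrite <- (hyp_wronskian (quartic_mod p) (quartic_mod_01 p Bp)). unfold wronskian.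
  set (l1 := quartic_slope p) in *. set (l2 := quartic_slope3 p) in *.
  set (l5 := quintic_slope t) in *.
  assert (Hr5 : 0 < (1 + 22 * t - 4 * t ^ 2) / (1 - 2 * t - 4 * t ^ 2))
    by (apply Rdiv_lt_0_compat; nra).
  assert (Hr1 : 0 < 1 + 4 * p + p ^ 2) by nra. assert (Hr2 : 0 < (3 - p ^ 2) / 3) by nra.
  set (r1 := 1 + 4 * p + p ^ 2) in *. set (r2 := (3 - p ^ 2) / 3) in *.
  set (r5 := (1 + 22 * t - 4 * t ^ 2) / (1 - 2 * t - 4 * t ^ 2)) in *.
  (* [b * c / 3] is the square root of [5 / 3]. *)
  assert (Hroot : sqrt r5 * sqrt r2 = b * c / 3 * sqrt r1).
  { rewrite <- sqrt_mult by lra. rewrite Hr, sqrt_mult by lra. f_equal.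
    apply sqrt_lem_1; [lra|nra|]. field [Hb Hc]. }
  pose proof (sqrt_sqrt r1 ltac:(lra)) as S1. pose proof (sqrt_sqrt r2 ltac:(lra)) as S2.
  pose proof (sqrt_lt_R0 r1 Hr1) as P1. pose proof (sqrt_lt_R0 r2 Hr2) as P2.
  pose proof (sqrt_lt_R0 r5 Hr5) as P5.
  set (m1 := sqrt r1) in *. set (m2 := sqrt r2) in *. set (m5 := sqrt r5) in *.
  assert (Q : 5 / m5 = b * c * m2 / m1).
  { apply Rmult_eq_reg_r with (m5 * m1); [|apply Rgt_not_eq, Rmult_lt_0_compat; lra].
    transitivity (5 * m1); [field; lra|].
    transitivity (b * c * (m5 * m2)); [|field; lra].
    rewrite Hroot. field [Hb Hc]. }
  rewrite D5, V5, D1, V1, D2, V2, Q, <- S1, <- S2.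
  replace (m5 * (m2 * g)) with (b * c / 3 * m1 * g) by (rewrite <- Hroot; ring).
  field. lra.
Qed.

Theorem theorem3p5 :
  is_series
    (fun n : nat =>
       pochhammer (1 / 3) n * pochhammer (1 / 2) n * pochhammer (2 / 3) n
         / (pochhammer 1 n) ^ 3
       * ((22617 * sqrt 15 + 27314 * sqrt 10 - 36036 * sqrt 6 - 87049) / 3375) ^ n
       * ((54 * sqrt 15 + 68 * sqrt 10 - 72 * sqrt 6 - 193) / 135
          + (63 * sqrt 15 + 71 * sqrt 10 - 63 * sqrt 6 - 217) / 45 * INR n))
    (1 / PI).
Proof.
  set (a := sqrt 2). set (b := sqrt 5). set (c := sqrt 3).
  replace (sqrt 15) with (b * c) by (unfold b, c; rewrite <- sqrt_mult by lra; f_equal; ring).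
  replace (sqrt 10) with (a * b) by (unfold a, b; rewrite <- sqrt_mult by lra; f_equal; ring).
  replace (sqrt 6) with (a * c) by (unfold a, c; rewrite <- sqrt_mult by lra; f_equal; ring).
  assert (a0 : 0 < a) by (apply sqrt_lt_R0; lra).
  assert (b0 : 0 < b) by (apply sqrt_lt_R0; lra).
  assert (c0 : 0 < c) by (apply sqrt_lt_R0; lra).
  assert (Ha : a ^ 2 = 2) by (apply pow2_sqrt; lra).
  assert (Hb : b ^ 2 = 5) by (apply pow2_sqrt; lra).
  assert (Hc : c ^ 2 = 3) by (apply pow2_sqrt; lra).
  destruct (cm_bounds a b c a0 b0 c0 Ha Hb Hc) as (Bp & Bt & Bp').
  pose proof (cm_quadratic_relation a b c a0 b0 c0 Ha Hb Hc Bp Bt) as Hrel.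
  pose proof (cm_constant_term a b c Ha Hb Hc Bp Bt Bp') as Hconst.
  destruct (cm_argument a b c Ha Hb Hc Bp') as [Hz HB].
  destruct (cubic_alpha_transformation (cm_p' a b c) Bp') as [V D].
  rewrite (cm_cubic_beta a b c Ha Hb Hc), sqrt_pow2 in V, D by lra.
  pose proof (cubic_alpha_bound (- cm_p' a b c) ltac:(lra)) as Hx. rewrite Ropp_involutive in Hx.
  cbv zeta in Hrel, Hconst. fold a in Hrel.
  set (p' := cm_p' a b c) in *. set (x := cubic_alpha p') in *. set (l := cubic_slope p') in *.
  unfold hyp_quad in V, D. unfold hyp_quad_flux in D. rewrite HB, <- Hz.
  set (z := 4 * x * (1 - x)) in *.
  assert (Hz1 : Rabs z < 1) by (apply Rabs_lt_between; unfold z; split; nra).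
  set (A := (54 * (b * c) + 68 * (a * b) - 72 * (a * c) - 193) / 135) in *.
  pose proof (is_series_hyp3 z A (a * b * c / 3 * (1 - 2 * x)) Hz1) as HS.
  match type of HS with is_series _ ?s => replace (1 / PI) with s; [exact HS|] end.
  set (g := F3 (cubic_beta (cm_p a b))) in *. set (ps := Phi3 (cubic_beta (cm_p a b))) in *.
  set (G := hyp (1 / 6) (1 / 3) z) in *. set (E := hyp_theta (1 / 6) (1 / 3) z) in *.
  pose proof PI_RGT_0 as HP.
  (* The factor [1 - 2 * x] of the coefficient of [n] turns [E], the value of
     [z * F6' z], into the flux. *)
  transitivity (A * G ^ 2 + 2 * (a * b * c / 3) * G * ((1 - 2 * x) * E)); [ring|].
  rewrite D, V.
  transitivity ((1 + p') ^ 2 * (A + 2 * (a * b * c) / 3 * l) * g ^ 2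
    + a * (4 * (b * c) / 3 * (g * ps))); [field; lra|].
  rewrite Hconst.
  match type of Hrel with ?k * _ + ?r = _ =>
    transitivity (a * (k * g ^ 2 + r)); [ring|] end.
  rewrite Hrel. field. lra.
Qed.
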